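(* Let $k\ge1$ and $n\ge0$ be integers. Then $$N_{4,k}(n)=p_{4,2}(n,k)\qquad\text{and}\qquad N_{5,k}(n)=\bar{p}_{4,2}(n,k).$$
   Context: A $k$-color partition of $n$ is a finite multiset of positive integers (parts), each carrying one of the $k$ colors $color(1),\dots,color(k)$, whose sum is $n$; repetitions are allowed. $\mathcal{N}_k(n)$ is the set of $k$-color partitions of $n$ in which even parts may occur only in the $k-1$ colors $color(2),\dots,color(k)$ (odd parts may occur in all $k$ colors). $N_{4,k}(n)$ (resp. $N_{5,k}(n)$) is the number of partitions in $\mathcal{N}_k(n)$ in which the number of even parts in $color(k)$, counted with multiplicity, is even (resp. odd). For a $k$-color partition $\lambda$ of $n$ in which parts $\equiv 0\pmod 2$ occur only in $color(2),\dots,color(k)$, i.e. $\lambda\in\mathcal{N}_k(n)$, let $\mathrm{Mex}_{4,2}(\lambda,k)$ be the smallest positive integer $\equiv 2\pmod 4$ that does not occur as a part in $color(k)$ of $\lambda$. $p_{4,2}(n,k)$ (resp. $\bar{p}_{4,2}(n,k)$) is the number of such $\lambda$ with $\mathrm{Mex}_{4,2}(\lambda,k)\equiv 2\pmod 8$ (resp. $\equiv 6\pmod 8$). *)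

(* Defs.v *)
From mathcomp Require Import all_boot.
From mathcomp Require Import finmap multiset.

Set Implicit Arguments.
Unset Strict Implicit.
Unset Printing Implicit Defensive.

Local Open Scope mset_scope.
Local Open Scope nat_scope.

(* A multiset of coloured parts of total size n uses parts in {1, ..., n}, each
   at most n times, so it is given by its multiplicity function, which lives in
   a finite type. The index (i, c) stands for the part i.+1 in color(c.+1):
   parts and colours are numbered from 1. The lemmas [mset_of_mults] and
   [mults_of_mset] below relate this encoding to {mset nat * 'I_k}. *)
Definition mults (n k : nat) := {ffun 'I_n * 'I_k -> 'I_n.+1}.

Definition part n k (x : 'I_n * 'I_k) : nat := x.1.+1.
Definition color n k (x : 'I_n * 'I_k) : nat := x.2.+1.

Definition weight n k (l : mults n k) : nat := \sum_x l x * part x.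

Definition kcolor_partitions n k : {set mults n k} :=
  [set l : mults n k | weight l == n].

Definition occurs n k (l : mults n k) (m c : nat) : bool :=
  [exists x, [&& 0 < l x, part x == m & color x == c]].

Definition Nset k n : {set mults n k} :=
  [set l in kcolor_partitions n k |
     [forall x, (0 < l x) && ~~ odd (part x) ==> (1 < color x)]].

Definition num_even_parts n k (l : mults n k) (c : nat) : nat :=
  \sum_(x | ~~ odd (part x) && (color x == c)) l x.

Definition N4 k n : nat :=
  #|[set l in Nset k n | ~~ odd (num_even_parts l k)]|.
Definition N5 k n : nat :=
  #|[set l in Nset k n | odd (num_even_parts l k)]|.

Lemma mex42_exists n k (l : mults n k) :
  exists m, [&& 0 < m, m == 2 %[mod 4] & ~~ occurs l m k].
Proof.
exists (4 * n + 2); rewrite addn2 /= -addn2 mulnC modnMDl eqxx /=.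
apply/existsPn => -[i c]; apply/negP => /and3P[_ /eqP Ei _].
move: (ltn_ord i); rewrite -[X in X <= _]/(part (i, c)) Ei.
by rewrite leqNgt addn2 ltnS mulnC (leq_trans (leq_pmull n (isT : 0 < 4))).
Qed.

Definition Mex42 n k (l : mults n k) : nat := ex_minn (mex42_exists l).

Definition p42 n k : nat :=
  #|[set l in Nset k n | Mex42 l == 2 %[mod 8]]|.
Definition pbar42 n k : nat :=
  #|[set l in Nset k n | Mex42 l == 6 %[mod 8]]|.

Definition is_kcolor_mset n k (A : {mset nat * 'I_k}) : Prop :=
  (forall a, a \in A -> 0 < a.1) /\ \sum_(a <- A) a.1 = n.

Definition encodes n k (l : mults n k) (A : {mset nat * 'I_k}) : Prop :=
  forall x, A (part x, x.2) = l x.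

Lemma mults_of_mset n k (A : {mset nat * 'I_k}) :
  is_kcolor_mset n A ->
  exists2 l, l \in kcolor_partitions n k &
    forall l', encodes l' A <-> l' = l.
Proof.
move=> [Apos Asum].
have lePA a : A a * a.1 <= n.
  rewrite -Asum sum_mset /=; have [aA|aA] := boolP (a \in A); last first.
    by rewrite (mset_eq0P aA).
  rewrite (big_fsetD1 a) ?msuppE //=.
  by rewrite leq_addr.
have leA (x : 'I_n * 'I_k) : A (part x, x.2) < n.+1.
  by rewrite ltnS (leq_trans _ (lePA (part x, x.2))) // leq_pmulr.
exists [ffun x => Ordinal (leA x)]; last first.
  move=> l'; split=> [h|-> x]; last by rewrite ffunE.
  by apply/ffunP=> x; apply/val_inj; rewrite ffunE /= h.
rewrite inE; apply/eqP; rewrite /weight -[RHS]Asum sum_mset /=.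
pose f (x : 'I_n * 'I_k) := (part x, x.2).
have f_inj : injective f.
  by move=> [i c] [j d] [] /eqP; rewrite ?eqSS => /eqP/val_inj -> ->.
transitivity (\sum_(x | f x \in A) A (f x) * (f x).1).
  rewrite [RHS]big_mkcond /=; apply: eq_bigr => x _; rewrite ffunE /=.
  by case: ifPn => // /mset_eq0P; rewrite /f => ->.
rewrite -big_filter -(big_map f xpredT (fun a => A a * a.1)).
apply: perm_big; apply: uniq_perm; first 1 last.
- exact: fset_uniq.
- move=> a; rewrite msuppE; apply/mapP/idP => [[x]|aA].
    by rewrite mem_filter => /andP[? _] ->.
  have a0 := Apos _ aA; have ltan : a.1.-1 < n.
    rewrite prednK // (leq_trans _ (lePA a)) // leq_pmull //.
    by rewrite mset_gt0.
  have Ea : a = f (Ordinal ltan, a.2).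
    by case: a a0 aA ltan => /= m c m0 _ ltm; rewrite /f /part /= prednK.
  by exists (Ordinal ltan, a.2); rewrite ?mem_filter -?Ea ?aA ?mem_index_enum.
by rewrite map_inj_uniq // filter_uniq // index_enum_uniq.
Qed.

Lemma mset_of_mults n k (l : mults n k) :
  l \in kcolor_partitions n k ->
  exists2 A, is_kcolor_mset n A & forall A', is_kcolor_mset n A' ->
    (encodes l A' <-> A' = A).
Proof.
rewrite inE => /eqP Wl.
pose f (x : 'I_n * 'I_k) := (part x, x.2).
have f_inj : injective f.
  by move=> [i c] [j d] [] /eqP; rewrite ?eqSS => /eqP/val_inj -> ->.
pose s := flatten [seq nseq (l x) (f x) | x <- index_enum ('I_n * 'I_k)%type].
have sum_s (F : nat * 'I_k -> nat) : \sum_(a <- s) F a = \sum_x l x * F (f x).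
  rewrite big_flatten big_map; apply: eq_bigr => x _.
  by rewrite big_nseq iter_addn_0 mulnC.
have encs : encodes l (seq_mset s).
  move=> x; rewrite mset_seqE -sum1_count big_mkcond sum_s (bigD1 x) //=.
  rewrite -/(f x) eqxx muln1 big1 ?addn0 // => y yx.
  by rewrite (inj_eq f_inj) (negPf yx) muln0.
have Ks : is_kcolor_mset n (seq_mset s).
  split; last by rewrite (perm_big _ (perm_eq_seq_mset s)) sum_s.
  move=> a; rewrite (perm_mem (perm_eq_seq_mset s)) => /flattenP[t].
  by case/mapP=> x _ -> /nseqP[-> _].
exists (seq_mset s) => // A' KA'; split=> [enc|-> //].
have small (B : {mset nat * 'I_k}) a : is_kcolor_mset n B -> a \in B ->
    exists x, a = f x.
  move=> [Bpos Bsum] aB; have a0 := Bpos _ aB.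
  have ltan : a.1.-1 < n.
    by rewrite prednK // -Bsum (big_rem a) //= leq_addr.
  exists (Ordinal ltan, a.2).
  by case: a a0 aB ltan => /= m c m0 _ ltm; rewrite /f /part /= prednK.
apply/msetP => a.
have [aA|aA] := boolP (a \in A').
  by have [x ->] := small _ _ KA' aA; rewrite [LHS]enc [RHS]encs.
have [aB|aB] := boolP (a \in seq_mset s).
  by have [x ->] := small _ _ Ks aB; rewrite [LHS]enc [RHS]encs.
by rewrite (mset_eq0P aA) (mset_eq0P aB).
Qed.

(* Main.v *)
Require Import Defs.
From mathcomp Require Import all_boot.
From mathcomp Require Import ssralg ssrint poly.
From mathcomp Require Import zify ring.

(* For k > 1 the even parts of color k are unrestricted. Modulo X^(n+1), let A
   be the generating function of Nset and S the one in which each even part of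
   color k carries a sign -1, so that S prod (1 + X^(2i)) = A prod (1 - X^(2i)).
   If the mex is 4 J + 2, the parts 2, 6, ..., 4 j - 2 all occur iff j <= J;
   removing one copy of each lowers the weight by 2 j^2, so that p42 is the
   coefficient of A sum_(j >= 0) (-1)^j X^(2 j^2). Both counts then agree by
   Gauss's identity, in the variable q = X^2,
     1 + 2 sum_(j > 0) (-1)^j q^(j^2) = prod (1 - q^i) / (1 + q^i),
   which follows from a finite form proved by telescoping: with
   (a)_s = prod_(i < s) (1 - a q^i) and G_n the truncation at j <= n,
     (-q)_n G_n = sum_(s <= n) (-1)^s (-1)_s ((q)_n / (q)_s) q^(s (n+1)). *)

(** * Coloured parts, the mex and complementary counts *)

Section ColoredParts.
Set Implicit Arguments.
Unset Strict Implicit.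
Variables n k : nat.
Implicit Types (x : 'I_n * 'I_k) (l : mults n k).

Lemma occurs_part l x m c :
  part x = m -> color x = c -> occurs l m c = (0 < l x).
Proof.
move=> <- <- {m c}.
apply/existsP/idP => [[y /and3P[ly /eqP Ep /eqP Ec]] | lx].
  suff <- : y = x by [].
  case: x y Ep Ec {ly} => i c [j d] /=; rewrite /part /color /=.
  by move=> [] /val_inj-> [] /val_inj->.
by exists x; rewrite lx !eqxx.
Qed.

Lemma occurs_leq l m c : occurs l m c -> m <= n.
Proof. by case/existsP=> -[i d] /and3P[_ /eqP <- _]; apply: ltn_ord. Qed.

Lemma big_color (T : Type) (idx : T) (op : Monoid.com_law idx)
    (P : pred nat) (h : nat -> T) : 0 < k ->
  \big[op/idx]_(x : 'I_n * 'I_k | P (part x) && (color x == k)) h (part x) =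
  \big[op/idx]_(1 <= m < n.+1 | P m) h m.
Proof.
case: k => // k' _; rewrite big_add1 big_mkord /=.
rewrite (reindex_onto (fun i : 'I_n => (i, @ord_max k')) fst) => [|[i c]] /=.
  by apply: eq_bigl => i; rewrite /part /color /= !eqxx !andbT.
rewrite /color /= eqSS => /andP[_ /eqP Ec]; congr (_, _).
by apply: val_inj; rewrite /= Ec.
Qed.

Lemma big_even (T : Type) (idx : T) (op : Monoid.com_law idx)
    (h : nat -> T) N :
  \big[op/idx]_(1 <= m < N.+1 | ~~ odd m) h m =
  \big[op/idx]_(1 <= i < N./2.+1) h (2 * i).
Proof.
elim: N => [|N IHN]; first by rewrite !big_geq.
rewrite big_mkcond big_nat_recr //= -big_mkcond IHN uphalf_half.
case: (boolP (odd N)) => oN /=; last by rewrite Monoid.mulm1.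
rewrite add1n [RHS]big_nat_recr //=; congr (op _ (h _)).
by rewrite -[in LHS](odd_double_half N) oN -mul2n mulnS.
Qed.

Lemma sum_2mod4 j : \sum_(0 <= m < 4 * j | m %% 4 == 2) m = 2 * j ^ 2.
Proof.
elim: j => [|j IHj]; first by rewrite big_geq.
rewrite mulnS !addSn add0n big_mkcond !big_nat_recr //= -big_mkcond IHj.
have E i : (i + 4 * j) %% 4 = i %% 4 by rewrite addnC mulnC modnMDl.
by rewrite (E 0) (E 1) (E 2) (E 3) /=; nia.
Qed.

(** Turns the mex into occurrence conditions, which generating functions can express. The bound on
    [J] ensures that the alternating sum over [j <= n./2] reaches every prefix. *)
Lemma Mex42P l : exists J, [/\ Mex42 l = 4 * J + 2, J <= n./2 &
  forall j, [forall i : 'I_j, occurs l (4 * i + 2) k] = (j <= J)].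
Proof.
rewrite /Mex42; case: ex_minnP => m /and3P[_ /eqP m4 nocc] minm.
have Em : m = 4 * (m %/ 4) + 2 by rewrite {1}(divn_eq m 4) m4 mulnC.
have occ i : i < m %/ 4 -> occurs l (4 * i + 2) k.
  move=> lti; apply: contraT => nocci.
  have lim : 4 * i + 2 < m by lia.
  suff: m <= 4 * i + 2 by rewrite leqNgt lim.
  apply: minm.
  by rewrite nocci addn2 /= -addn2 mulnC modnMDl.
exists (m %/ 4); split=> // [|j].
  have [-> //|J0] := posnP (m %/ 4).
  have /occurs_leq : occurs l (4 * (m %/ 4).-1 + 2) k by apply: occ; lia.
  lia.
apply/forallP/idP => [occj | lej i]; last by apply: occ; apply: leq_trans lej.
rewrite leqNgt; apply/negP=> ltJj; case/negP: nocc.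
by rewrite Em (occj (Ordinal ltJj)).
Qed.

Lemma card_Nset_split (P Q : pred (mults n k)) : (forall l, Q l = ~~ P l) ->
  #|[set l in Nset k n | P l]| + #|[set l in Nset k n | Q l]| = #|Nset k n|.
Proof.
move=> QP; rewrite -(cardsID [set l | P l] (Nset k n)); congr (_ + _).
  by apply: eq_card => l; rewrite !inE.
by apply: eq_card => l; rewrite !inE QP andbC.
Qed.

Lemma N4_N5 : N4 k n + N5 k n = #|Nset k n|.
Proof. by apply: card_Nset_split => l; rewrite negbK. Qed.

Lemma p42_pbar42 : p42 n k + pbar42 n k = #|Nset k n|.
Proof.
by apply: card_Nset_split => l; have [J [-> _ _]] := Mex42P l; lia.
Qed.

(** With a single colour no even part occurs, so the number of even parts is 0 and the mex is 2 for
    every [l] in [Nset]. *)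
Lemma N4_p42_color1 : k = 1 -> N4 k n = p42 n k.
Proof.
move=> k1; apply: eq_card => l; rewrite !inE.
case: (weight l == n) => //; case: forallP => // noeven; rewrite !andTb.
have -> : num_even_parts l k = 0.
  rewrite /num_even_parts big1 // => x /andP[ex /eqP Ec].
  have {}Ec : color x = 1 by rewrite Ec.
  by have := noeven x; rewrite ex Ec andbT implybF -leqNgt leqn0 => /eqP.
have [J [-> _ occ]] := Mex42P l.
suff -> : J = 0 by [].
apply/eqP; rewrite -leqn0 leqNgt -(occ 1); apply/negP=> /forallP /(_ ord0).
case/existsP=> x /and3P[lx /eqP Ep /eqP Ec].
have {}Ec : color x = 1 by rewrite Ec.
by have := noeven x; rewrite lx Ep Ec.
Qed.

End ColoredParts.

(** * Finite form of Gauss's identity for squares *)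

Section GaussSquares.
Set Implicit Arguments.
Unset Strict Implicit.
Import GRing.Theory.
Local Open Scope ring_scope.
Variables (R : comNzRingType) (y : R).

Definition gauss_sum n : R :=
  (\sum_(0 <= j < n.+1) (-1) ^+ j * y ^+ (j ^ 2)) *+ 2 - 1.

(** [up s] is (-1)_s, whose factor at i = 0 is 2; [tail s.+1 n.+1] is the quotient (q)_n / (q)_s,
    written without division. *)
Let up s : R := \prod_(0 <= i < s) (1 + y ^+ i).
Let tail s n : R := \prod_(s <= i < n) (1 - y ^+ i).
Let term n s : R := (-1) ^+ s * up s * tail s.+1 n.+1 * y ^+ (s * n.+1).

(* As [1 - y ^+ 0 = 0], the right-hand side vanishes at [m = 0]. *)
Lemma term_telescope n m : (m <= n.+1)%N ->
  \sum_(0 <= s < m) (term n.+1 s - (1 + y ^+ n.+1) * term n s) =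
  (-1) ^+ m * up m * tail m n.+1 * y ^+ (m * n.+1).
Proof.
elim: m => [|m IHm] ltmn.
  by rewrite big_geq // /tail big_ltn // expr0 subrr mul0r mulr0 mul0r.
rewrite big_nat_recr //= {}IHm 1?ltnW // /term.
have -> : tail m n.+1 = (1 - y ^+ m) * tail m.+1 n.+1.
  by rewrite /tail (big_ltn ltmn).
have -> : tail m.+1 n.+2 = tail m.+1 n.+1 * (1 - y ^+ n.+1).
  by rewrite /tail big_nat_recr.
have -> : up m.+1 = up m * (1 + y ^+ m) by rewrite /up big_nat_recr.
have -> : (m * n.+2 = m * n.+1 + m)%N by rewrite [LHS]mulnS addnC.
have -> : (m.+1 * n.+1 = m * n.+1 + n.+1)%N by rewrite [LHS]mulSn addnC.
rewrite [(-1) ^+ m.+1]exprS !(exprD y (m * _)).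
move: (y ^+ n.+1) (y ^+ (m * _)) (tail m.+1 n.+1) => u v t.
ring.
Qed.

(** Induction on [n]. The telescoped difference at [m = n.+1] and the new last term both carry the
    factor [up n.+1]; its factor 2 matches the doubled new square on the left. *)
Lemma gauss_sum_up n :
  \prod_(1 <= i < n.+1) (1 + y ^+ i) * gauss_sum n =
  \sum_(0 <= s < n.+1) term n s.
Proof.
elim: n => [|n IHn].
  rewrite /gauss_sum /term /up /tail big_geq // !big_nat1 !big_geq //.
  by rewrite !expr0 !mul1r mulr2n addrK.
have -> : gauss_sum n.+1 =
    gauss_sum n + ((-1) ^+ n.+1 * y ^+ (n.+1 ^ 2)) *+ 2.
  by rewrite /gauss_sum big_nat_recr //= mulrnDl addrAC.
rewrite big_nat_recr //= mulrDr [X in X + _]mulrAC IHn.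
rewrite [RHS]big_nat_recr //=.
have /eqP := @term_telescope n n.+1 (leqnn _).
rewrite sumrB -mulr_sumr subr_eq => /eqP ->.
have tail_id m : tail m m = 1 by rewrite /tail big_geq.
rewrite /term !tail_id -mulnn.
have -> : up n.+1 = 2%:R * \prod_(1 <= i < n.+1) (1 + y ^+ i).
  by rewrite /up big_ltn // expr0.
have -> : (n.+1 * n.+2 = n.+1 * n.+1 + n.+1)%N by rewrite [LHS]mulnS addnC.
rewrite exprD; move: (\prod_(1 <= i < n.+1) _) => P.
move: (y ^+ n.+1) (y ^+ (n.+1 * n.+1)) ((-1) ^+ n.+1) => u v e.
ring.
Qed.

(** The term at s = 0 is the product on the right; every later term is divisible by [y ^+ n.+1]. *)
Lemma gauss_sum_cong n : exists r,
  \prod_(1 <= i < n.+1) (1 + y ^+ i) * gauss_sum n =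
  \prod_(1 <= i < n.+1) (1 - y ^+ i) + y ^+ n.+1 * r.
Proof.
exists (\sum_(1 <= s < n.+1)
  (-1) ^+ s * up s * tail s.+1 n.+1 * y ^+ (s.-1 * n.+1)).
have up0 : up 0 = 1 by rewrite /up big_geq.
rewrite gauss_sum_up [LHS]big_ltn // {1}/term up0 !mul1r mulr1.
rewrite mulr_sumr; congr (_ + _); apply: eq_big_nat => -[//|s] _.
by rewrite /term mulSn exprD /=; ring.
Qed.

End GaussSquares.

(** * Congruence modulo a ring element *)

Section Congruence.
Set Implicit Arguments.
Unset Strict Implicit.
Import GRing.Theory.
Local Open Scope ring_scope.
Variables (R : comNzRingType) (z : R).

Definition cong (a b : R) : Prop := exists r, a = b + z * r.

Lemma cong_refl a : cong a a.
Proof. by exists 0; rewrite mulr0 addr0. Qed.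

Lemma cong_sym a b : cong a b -> cong b a.
Proof. by case=> r ->; exists (- r); rewrite mulrN addrK. Qed.

Lemma cong_trans b a c : cong a b -> cong b c -> cong a c.
Proof. by case=> r -> [t ->]; exists (t + r); rewrite mulrDr addrA. Qed.

Lemma cong_mul a b c d : cong a b -> cong c d -> cong (a * c) (b * d).
Proof. by case=> r -> [t ->]; exists (r * d + b * t + r * z * t); ring. Qed.

Lemma cong_prod (I : finType) (P : pred I) (F G : I -> R) :
  (forall x, P x -> cong (F x) (G x)) ->
  cong (\prod_(x | P x) F x) (\prod_(x | P x) G x).
Proof.
move=> FG.
by apply: big_ind2 => //; [apply: cong_refl | apply: cong_mul].
Qed.

End Congruence.

(** * Generating functions of multiplicity functions *)

Section GeneratingFunctions.
Set Implicit Arguments.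
Unset Strict Implicit.
Import GRing.Theory.
Local Open Scope ring_scope.
Variables n k : nat.
Implicit Types (x : 'I_n * 'I_k) (l : mults n k).

Let congX := cong ('X^(n.+1) : {poly int}).

Lemma cong_coef p q : congX p q -> p`_n = q`_n.
Proof. by case=> r ->; rewrite coefD coefXnM ltnSn addr0. Qed.

Lemma cong_geom (u : {poly int}) :
  congX (u ^+ n.+1) 0 -> congX ((1 - u) * \sum_(i < n.+1) u ^+ i) 1.
Proof.
case=> r; rewrite add0r => Eu; exists (- r).
by rewrite -opprB mulNr -subrX1 opprB Eu mulrN.
Qed.

Definition gf (F : 'I_n * 'I_k -> nat -> int) : {poly int} :=
  \prod_x \sum_(i < n.+1) (F x i)%:P * 'X^(i * part x).

(** Choosing one index in each factor of the expanded product amounts to choosing some [l] in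
    [mults n k], and the resulting monomial has degree [weight l]. *)
Lemma coef_gf F :
  (gf F)`_n = \sum_(l in kcolor_partitions n k) \prod_x F x (l x).
Proof.
rewrite /gf bigA_distr_bigA coef_sum [RHS]big_mkcond; apply: eq_bigr => l _.
rewrite inE big_split /= -rmorph_prod coefCM -expr_sum coefXn -/(weight l).
by rewrite eq_sym; case: eqP; rewrite ?mulr1 ?mulr0.
Qed.

Lemma prod_bool (I : finType) (P : pred I) :
  \prod_x (P x)%:R = [forall x, P x]%:R :> int.
Proof.
case: forallP => [allP | /forallP/forallPn[x /negPf nPx]].
  by rewrite big1 // => x _; rewrite allP.
by rewrite (bigD1 x) //= nPx mul0r.
Qed.

Lemma natr_card (T : finType) (A : {set T}) :
  #|A|%:R = \sum_x (x \in A)%:R :> int.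
Proof.
rewrite -sum1_card natr_sum big_mkcond.
by apply: eq_bigr => x _; case: (x \in A).
Qed.

Lemma coef_gf_count (P : 'I_n * 'I_k -> nat -> bool) :
  (gf (fun x i => (P x i)%:R))`_n =
  #|[set l in kcolor_partitions n k | [forall x, P x (l x)]]|%:R.
Proof.
rewrite coef_gf natr_card big_mkcond; apply: eq_bigr => l _.
by rewrite !inE prod_bool; case: (_ == _).
Qed.

End GeneratingFunctions.

(** * Signed counts for at least two colours *)

Section SignedCounts.
Set Implicit Arguments.
Unset Strict Implicit.
Import GRing.Theory.
Local Open Scope ring_scope.
Variables n k : nat.
Implicit Types (x : 'I_n * 'I_k) (l : mults n k).
Hypothesis k_gt1 : (1 < k)%N.

Let k_gt0 : (0 < k)%N := ltnW k_gt1.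
Let congX := cong ('X^(n.+1) : {poly int}).

Definition allowed x (i : nat) :=
  ((0 < i) && ~~ odd (part x) ==> (1 < color x))%N.
Definition evenk x := ~~ odd (part x) && (color x == k).
Definition req j x :=
  (((part x %% 4 == 2) && (part x < 4 * j)) && (color x == k))%N.

Lemma allowed_evenk x i : color x = k -> allowed x i.
Proof. by rewrite /allowed => ->; rewrite k_gt1 implybT. Qed.

Definition gfN := gf (fun x i => (allowed x i)%:R).
Definition gfN_signed :=
  gf (fun x i => (allowed x i)%:R * (-1) ^+ (evenk x * i)).

Lemma cong_Xn m : (n < m)%N -> congX 'X^m 0.
Proof.
by move=> ltnm; exists 'X^(m - n.+1); rewrite add0r -exprD subnKC.
Qed.

Lemma req_sum j : (4 * j <= n + 2)%N ->
  (\sum_(x : 'I_n * 'I_k | req j x) part x = 2 * j ^ 2)%N.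
Proof.
move=> le4j; rewrite -sum_2mod4.
rewrite /req (big_color _ _ (fun m => (m %% 4 == 2) && (m < 4 * j))%N id) //.
rewrite [RHS](big_nat_widen _ _ n.+2); last by lia.
rewrite [RHS]big_ltn_cond //= big_mkcond [RHS]big_mkcond.
rewrite [RHS]big_nat_recr //=.
(* The surplus index [n.+1] adds nothing: were it 2 mod 4 and below 4 j, it would be at most 4 j - 2
   <= n. *)
by case: ifP => [/andP[/eqP m4 mj]|_]; [lia | rewrite addn0].
Qed.

(** Requiring a part to occur shifts its geometric series by [part x]. The two truncations differ by
    a term of degree (n + 1) [part x], which exceeds n. *)
Lemma gf_required j : (4 * j <= n + 2)%N ->
  congX (gf (fun x i => (allowed x i && (req j x ==> (0 < i)%N))%:R))
        (gfN * 'X^(2 * j ^ 2)).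
Proof.
move=> le4j; rewrite -(req_sum le4j) expr_sum [X in _ * X]big_mkcond.
rewrite -big_split; apply: cong_prod => x _ /=.
case: (boolP (req j x)) => [reqx | _] /=; last first.
  by under eq_bigr do rewrite andbT; rewrite mulr1; apply: cong_refl.
have {reqx} allx i : allowed x i.
  by apply: allowed_evenk; case/andP: reqx => _ /eqP.
rewrite big_ord_recl [X in cong _ _ (X * _)]big_ord_recr /=.
rewrite mul0r add0r.
rewrite allx !mul1r mulrDl -exprD mulr_suml.
apply/cong_sym.
have [r ->] : congX 'X^(n * part x + part x) 0.
  by apply: cong_Xn; rewrite /part; nia.
exists r; rewrite add0r; congr (_ + _); apply: eq_bigr => i _.
by rewrite !allx andbT -mulrA -exprD /bump add1n mulSn addnC.
Qed.

Lemma coef_required j : (gfN * 'X^(2 * j ^ 2))`_n =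
  #|[set l in Nset k n | [forall i : 'I_j, occurs l (4 * i + 2) k]]|%:R.
Proof.
(* If 4 j > n + 2, both sides vanish: the required part 4 j - 2 exceeds n, and so does 2 j^2 >= 4 j
   - 2. *)
have [le4j | lt4j] := leqP (4 * j) (n + 2); last first.
  rewrite coefMXn ifT; last by nia.
  rewrite (_ : [set _ in _ | _] = set0) ?cards0 //; apply/setP=> l.
  rewrite !inE; apply/negP=> /andP[_ /forallP occ].
  have ltj : (j.-1 < j)%N by lia.
  by have /= /occurs_leq := occ (Ordinal ltj); lia.
rewrite -(cong_coef (gf_required le4j)) coef_gf_count.
congr (#|pred_of_set _|%:R).
apply/setP=> l; rewrite !inE -andbA; congr (_ && _).
apply/forallP/andP=> [allP | [/forallP allN /forallP occ] x].
  split; apply/forallP; first by move=> x; case/andP: (allP x).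
  move=> i.
  have lti : (4 * i + 1 < n)%N by have := ltn_ord i; lia.
  have ltk : (k.-1 < k)%N by lia.
  pose x := (Ordinal lti, Ordinal ltk).
  have Ep : part x = (4 * i + 2)%N by rewrite /part /=; lia.
  have Ec : color x = k by rewrite /color /= prednK.
  have := allP x; rewrite (occurs_part l Ep Ec) => /andP[_ /implyP]; apply.
  rewrite /req Ec Ep eqxx andbT; have := ltn_ord i; lia.
rewrite [allowed _ _]allN /=; apply/implyP=> /andP[/andP[/eqP x4 ltx] /eqP Ec].
have ltj : (part x %/ 4 < j)%N by lia.
by have := occ (Ordinal ltj); rewrite (occurs_part l _ Ec) //=; lia.
Qed.

(** At an even part p of color k, the signed and unsigned factors invert 1 + X^p and 1 - X^p. Hence
    both sides agree after multiplication by [up], which is then cancelled using its inverse [v]. *)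
Lemma gfN_signed_cong :
  congX gfN_signed (gfN * gauss_sum ('X^2) n./2).
Proof.
pose a x : {poly int} := \sum_(i < n.+1) (allowed x i)%:R%:P * 'X^(i * part x).
pose s x : {poly int} :=
  \sum_(i < n.+1)
     ((allowed x i)%:R * (-1) ^+ (evenk x * i))%:P * 'X^(i * part x).
pose up := \prod_(x | evenk x) (1 + 'X^(part x) : {poly int}).
pose down := \prod_(x | evenk x) (1 - 'X^(part x) : {poly int}).
have reindex (h : nat -> {poly int}) :
    \prod_(x | evenk x) h (part x) = \prod_(1 <= i < (n./2).+1) h (2 * i)%N.
  by rewrite /evenk (big_color _ _ (fun m => ~~ odd m) h) // big_even.
have gauss : congX (up * gauss_sum 'X^2 n./2) down.
  rewrite /up /down (reindex (fun m => 1 + 'X^m)) (reindex (fun m => 1 - 'X^m)).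
  under eq_bigr do rewrite exprM.
  under [X in congX _ X]eq_bigr do rewrite exprM.
  have [r ->] := gauss_sum_cong ('X^2 : {poly int}) n./2.
  (* The error term of the finite identity has a factor of degree above n, so it disappears. *)
  rewrite -exprM; have [t ->] : congX 'X^(2 * n./2.+1) 0 by apply: cong_Xn; lia.
  by exists (t * r); rewrite add0r mulrA.
have small x : congX ('X^(part x) ^+ n.+1) 0.
  by rewrite -exprM; apply: cong_Xn; rewrite /part; nia.
have a_inv x : evenk x -> congX ((1 - 'X^(part x)) * a x) 1.
  case/andP=> _ /eqP Ec; rewrite /a.
  under eq_bigr do rewrite (allowed_evenk _ Ec) mul1r mulnC exprM.
  exact/cong_geom/small.
have s_inv x : evenk x -> congX ((1 + 'X^(part x)) * s x) 1.
  move=> ex; have /andP[_ /eqP Ec] := ex; rewrite /s ex.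
  under eq_bigr => i _.
    rewrite (allowed_evenk _ Ec) !mul1r mul1n rmorphXn rmorphN1 mulnC exprM.
    rewrite -exprMn mulN1r.
  over.
  rewrite -[X in 1 + X]opprK; apply: cong_geom.
  rewrite exprNn; have [r ->] := small x; exists ((-1) ^+ n.+1 * r).
  by rewrite !add0r mulrCA.
pose v := \prod_(x | evenk x) s x.
have v_inv : congX (up * v) 1.
  by have := cong_prod s_inv; rewrite big1_eq big_split.
have up_down : congX (gfN_signed * up) (gfN * down).
  rewrite /up /down ![\prod_(x | evenk x) _]big_mkcond /=.
  have factor x : congX (s x * (if evenk x then 1 + 'X^(part x) else 1))
                        (a x * (if evenk x then 1 - 'X^(part x) else 1)).
    case: ifP => ex.
      rewrite mulrC; apply: cong_trans (s_inv _ ex) _.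
      by rewrite mulrC; apply/cong_sym/a_inv.
    rewrite !mulr1 /s ex; under eq_bigr do rewrite mul0n mulr1.
    exact: cong_refl.
  have := @cong_prod _ 'X^(n.+1) _ xpredT _ _ (fun x _ => factor x).
  by rewrite !big_split.
set G := gauss_sum _ _ in gauss *.
rewrite -[gfN_signed]mulr1 -[gfN * G]mulr1.
have cancel p q : congX (p * up) (q * up) -> congX (p * 1) (q * 1).
  move=> pq; have cv r : congX (r * 1) (r * up * v).
    by rewrite -mulrA; apply/cong_mul/cong_sym/v_inv/cong_refl.
  apply: cong_trans (cv p) (cong_trans _ (cong_sym (cv q))).
  exact/cong_mul/cong_refl.
apply: cancel; apply: cong_trans up_down _.
rewrite -mulrA [G * _]mulrC.
by apply: cong_mul (cong_refl _ _) (cong_sym gauss).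
Qed.

Lemma coef_gfN_signed : gfN_signed`_n = (N4 k n)%:R - (N5 k n)%:R.
Proof.
rewrite coef_gf /N4 /N5 !natr_card -sumrB big_mkcond.
apply: eq_bigr => l _; rewrite !inE big_split prod_bool /= -/(allowed _ _).
case: (weight l == n) => /=; last by rewrite subrr.
have -> : \prod_x (-1) ^+ (evenk x * l x) = (-1) ^+ num_even_parts l k :> int.
  rewrite -expr_sum; congr (_ ^+ _); rewrite /num_even_parts [RHS]big_mkcond.
  by apply: eq_bigr => x _; rewrite /evenk; case: (_ && _); rewrite ?mul1n.
rewrite -signr_odd; case: [forall x, _] => /=; last by rewrite mul0r subrr.
by rewrite mul1r; case: (odd _).
Qed.

(** Detects the parity of [J], hence whether the mex 4 J + 2 is 2 or 6 mod 8. *)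
Lemma alternating_prefix J m : (J <= m)%N ->
  \sum_(0 <= j < m.+1) (-1) ^+ j * (j <= J)%N%:R = (~~ odd J)%:R :> int.
Proof.
move=> leJm; rewrite (big_cat_nat (n := J.+1)) //= [X in _ + X]big_nat.
rewrite [X in _ + X]big1 ?addr0 => [|j /andP[ltJj _]]; last first.
  by rewrite leqNgt ltJj mulr0.
transitivity (\sum_(0 <= j < J.+1) (-1) ^+ j : int).
  by apply: eq_big_nat => j; rewrite ltnS => /andP[_ ->]; rewrite mulr1.
elim: J {leJm} => [|J IHJ]; first by rewrite big_nat1.
by rewrite big_nat_recr //= IHJ -signr_odd /=; case: (odd J).
Qed.

Lemma coef_p42 :
  (gfN * \sum_(0 <= j < n./2.+1) (-1) ^+ j * 'X^2 ^+ (j ^ 2))`_n = (p42 n k)%:R.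
Proof.
rewrite mulr_sumr coef_sum.
under eq_bigr => j _.
  rewrite -exprM mulrCA -(rmorphN1 polyC) -rmorphXn coefCM coef_required.
  rewrite natr_card mulr_sumr.
  over.
rewrite exchange_big /p42 natr_card; apply: eq_bigr => l _.
have [J [EJ leJ occ]] := Mex42P l.
transitivity ((l \in Nset k n)%:R *
  \sum_(0 <= j < n./2.+1) (-1) ^+ j * (j <= J)%N%:R : int).
  rewrite mulr_sumr; apply: eq_bigr => j _; rewrite inE occ.
  by case: (l \in _); case: (j <= J)%N; rewrite ?mulr1 ?mulr0 ?mul1r ?mul0r.
rewrite alternating_prefix // inE EJ.
have -> : (4 * J + 2 == 2 %[mod 8])%N = ~~ odd J by lia.
by case: (l \in _); case: (odd J).
Qed.

Lemma coef_gfN : gfN`_n = #|Nset k n|%:R.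
Proof.
have -> : gfN = gfN * 'X^(2 * 0 ^ 2) by rewrite mulr1.
rewrite coef_required; congr (#|pred_of_set _|%:R); apply/setP=> l.
by rewrite inE; case: forallP => [_|[]]; [rewrite andbT | case].
Qed.

(** Comparing coefficients of X^n gives N4 - N5 = 2 p42 - (N4 + N5). *)
Lemma N4_p42_gt1 : N4 k n = p42 n k.
Proof.
have := cong_coef gfN_signed_cong; rewrite coef_gfN_signed /gauss_sum mulrBr.
rewrite mulr1 coefB mulrnAr coefMn coef_p42 coef_gfN -N4_N5; lia.
Qed.

End SignedCounts.

Theorem theorem1p19 (k n : nat) (hk : 1 <= k) :
  N4 k n = p42 n k /\ N5 k n = pbar42 n k.
Proof.
(* Both pairs of counts add up to the size of [Nset k n], so the first equality implies the
   second. *)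
suff E : N4 k n = p42 n k.
  by split=> //; have := N4_N5 n k; rewrite -p42_pbar42 E => /addnI.
have [k_gt1 | k_le1] := ltnP 1 k; first exact: N4_p42_gt1.
by apply: N4_p42_color1; apply/eqP; rewrite eqn_leq k_le1.
Qed.
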